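(* Let $m,n$ be non-zero integers. The Riley polynomial $R_{n,m}$ of the rational knot $C(2n+1,2m,2)$ is $$R_{n,m}(x,y)=\big((x^2-y-1)S_m(\alpha)-S_{m-1}(\alpha)\big)S_n(\beta)-\big((x^2-y-1)S_{m-1}(\alpha)-S_{m-2}(\alpha)\big)S_{n-1}(\beta).$$
   Context: $S_k(z)$, $k\in\mathbb Z$, denotes the Chebyshev polynomials of the second kind defined by $S_0(z)=1$, $S_1(z)=z$ and $S_k(z)=zS_{k-1}(z)-S_{k-2}(z)$ for all integers $k$. The knot group of $C(2n+1,2m,2)$ is $\langle a,b\mid wa=bw\rangle$, where $w=v^n(aba^{-1}b^{-1})^m ab$ and $v=(aba^{-1}b^{-1})^m\,a\,(aba^{-1}b^{-1})^{-m}\,b$. For parameters $t\neq0$ and $u$, assign to words in $a,b$ matrices via $$\rho(a)=\begin{bmatrix} t&1\\0&t^{-1}\end{bmatrix},\qquad \rho(b)=\begin{bmatrix} t&0\\-u&t^{-1}\end{bmatrix},$$ and put $x=\operatorname{tr}\rho(a)=t+t^{-1}$, $y=\operatorname{tr}\rho(ab^{-1})=u+2$, $\alpha=\operatorname{tr}\rho(aba^{-1}b^{-1})$, $\beta=\operatorname{tr}\rho(v)$. (One has $\alpha=y^2-x^2y+2x^2-2$ and $\beta=2+(x^2-y-2)\big(S_m(\alpha)+(1-y)S_{m-1}(\alpha)\big)^2$.) The Riley polynomial is $R_{n,m}=w_{11}+(t^{-1}-t)w_{12}$, where $w_{ij}$ is the $(i,j)$ entry of $\rho(w)$, regarded as a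 polynomial in $x,y$; its vanishing is equivalent to the matrix equation $\rho(wa)=\rho(bw)$, i.e. to $\rho$ defining a representation of the knot group. *)

(* Defs.v *)
From HB Require Import structures.
From mathcomp Require Import all_boot all_order all_algebra.
From mathcomp Require Import ring.

Set Implicit Arguments.
Unset Strict Implicit.
Unset Printing Implicit Defensive.

Import Order.TTheory GRing.Theory Num.Theory.
Local Open Scope ring_scope.

Section Chebyshev.
Variable R : comNzRingType.
Implicit Types (z : R) (k : int).

(* The sequence p, q, z * q - p, ... *)
Fixpoint cheb_seq z (p q : R) (k : nat) : R :=
  if k is k'.+1 then cheb_seq z q (z * q - p) k' else p.

(* On the negative side the recurrence is run backwards,
   S_(k-2) = z S_(k-1) - S_k, from S_(-1) = 0 and S_(-2) = -1
   (Negz j is -(j+1)). *)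
Definition chebS k z : R :=
  match k with
  | Posz j => cheb_seq z 1 z j
  | Negz j => cheb_seq z 0 (- 1) j
  end.

Lemma cheb_seqSS z p q j :
  cheb_seq z p q j.+2 = z * cheb_seq z p q j.+1 - cheb_seq z p q j.
Proof. by elim: j p q => [|j IHj] p q //; apply: IHj. Qed.

Lemma chebS0 z : chebS 0 z = 1. Proof. by []. Qed.

Lemma chebS1 z : chebS 1 z = z. Proof. by []. Qed.

Lemma chebS_rec k z : chebS k z = z * chebS (k - 1) z - chebS (k - 2) z.
Proof.
case: k => [[|[|j]]|j].
- by rewrite /= mulr0 sub0r opprK.
- by rewrite /= mulr1 subr0.
- have -> : Posz j.+2 - 1 = Posz j.+1 by rewrite -[j.+2]addn1 PoszD addrK.
  have -> : Posz j.+2 - 2 = Posz j by rewrite -[j.+2]addn2 PoszD addrK.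
  exact: cheb_seqSS.
- have -> : Negz j - 1 = Negz j.+1 by rewrite !NegzE -opprD -PoszD addn1.
  have -> : Negz j - 2 = Negz j.+2 by rewrite !NegzE -opprD -PoszD addn2.
  rewrite [chebS (Negz j.+2) z]cheb_seqSS opprB.
  by rewrite [chebS (Negz j.+1) z]/chebS addrC subrK.
Qed.

End Chebyshev.

(* Words in a and b, evaluated at units a and b of a ring; for 2 x 2 matrices
   of determinant 1 this is the image of the word under rho. *)
Section Words.
Variables (G : unitRingType) (a b : G).

Definition word_c : G := a * b * a^-1 * b^-1.

Definition word_v (m : int) : G := word_c ^ m * a * word_c ^ (- m) * b.

Definition word_w (n m : int) : G := word_v m ^ n * word_c ^ m * a * b.

End Words.

Section Riley.
Variable C : numClosedFieldType.
Implicit Types (t u : C) (n m : int).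

Definition mx2 (p q r s : C) : 'M[C]_2 :=
  \matrix_(i < 2, j < 2)
    if i == 0 then if j == 0 then p else q else if j == 0 then r else s.

Definition rho_a t : 'M[C]_2 := mx2 t 1 0 t^-1.

Definition rho_b t u : 'M[C]_2 := mx2 t 0 (- u) t^-1.

Definition tra t : C := \tr (rho_a t).

Definition trab t u : C := \tr (rho_a t * (rho_b t u)^-1).

Definition tralpha t u : C := \tr (word_c (rho_a t) (rho_b t u)).

Definition trbeta m t u : C := \tr (word_v (rho_a t) (rho_b t u) m).

Definition riley n m t u : C :=
  let W : 'M[C]_2 := word_w (rho_a t) (rho_b t u) n m in
  W 0 0 + (t^-1 - t) * W 0 1.

(* P, with variables 'X for x and 'Y for y, is f regarded as a polynomial in
   x and y. *)
Definition xy_poly (f : C -> C -> C) (P : {poly {poly C}}) : Prop :=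
  forall t u, t != 0 -> P.[tra t, trab t u] = f t u.

Lemma det_mx2 p q r s : \det (mx2 p q r s) = p * s - q * r.
Proof.
rewrite (expand_det_row _ 0) !big_ord_recl big_ord0 /cofactor !det_mx11 !mxE /=.
by rewrite expr0 mul1r expr1 mulN1r mulrN addr0.
Qed.

Lemma rho_a_unit t : t != 0 -> rho_a t \is a GRing.unit.
Proof.
by move=> t0; rewrite unitmxE det_mx2 mulfV // mulr0 subr0 unitr1.
Qed.

Lemma rho_b_unit t u : t != 0 -> rho_b t u \is a GRing.unit.
Proof.
by move=> t0; rewrite unitmxE det_mx2 mulfV // mul0r subr0 unitr1.
Qed.

Lemma traE t : tra t = t + t^-1.
Proof. by rewrite /tra /mxtrace !big_ord_recl big_ord0 !mxE /= addr0. Qed.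

Lemma trabE t u : t != 0 -> trab t u = u + 2.
Proof.
move=> t0.
have bV : (rho_b t u)^-1 = mx2 t^-1 0 u t.
  apply: (mulrI (rho_b_unit u t0)); rewrite divrr ?rho_b_unit //.
  apply/matrixP=> i j; rewrite !mxE !big_ord_recl big_ord0 !mxE /=.
  by case: i => [[|[|]]] //= ?; case: j => [[|[|]]] //= ?; field.
rewrite /trab bV /mxtrace !big_ord_recl big_ord0 !mxE.
by rewrite !big_ord_recl !big_ord0 !mxE /=; field.
Qed.

End Riley.

(* Main.v *)
(** By Cayley-Hamilton, g^k = S_k(tr g) - S_(k-1)(tr g) g^-1 for g in SL_2.
    With c = a b a^-1 b^-1 we have v^-1 c^m a b = b^-1 c^m b, so this gives
    w = S_n(beta) c^m a b - S_(n-1)(beta) b^-1 c^m b.  The linear form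
    M |-> M_11 + (t^-1 - t) M_12, applied after expanding c^m in the same way,
    yields the two bracketed factors.  Uniqueness holds because every pair
    (x, y) is of the form (t + t^-1, u + 2) with t nonzero. *)
Require Import Defs.
From mathcomp Require Import all_boot all_order all_algebra.
From mathcomp Require Import ring.

Import Order.TTheory GRing.Theory Num.Theory.
Local Open Scope ring_scope.

(** * Chebyshev polynomials and integer powers *)

Lemma rmorph_chebS (R S : comNzRingType) (f : {rmorphism R -> S}) k z :
  f (chebS k z) = chebS k (f z).
Proof.
suff seqE j p q : f (cheb_seq z p q j) = cheb_seq (f z) (f p) (f q) j.
  by case: k => j; rewrite /chebS seqE ?rmorphN ?rmorph1 ?rmorph0.
by elim: j p q => //= j IHj p q; rewrite IHj rmorphB rmorphM.
Qed.

(** The hypothesis [g + g^-1 = z%:A] is Cayley-Hamilton for determinant 1; it turns multiplication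
    by [g] or [g^-1] into the Chebyshev recurrence, run upwards or downwards. *)
Lemma exprz_chebS (R : comUnitRingType) (A : unitAlgType R) (g : A) (z : R)
    (k : int) :
  g \is a GRing.unit -> g + g^-1 = z%:A ->
  g ^ k = (chebS k z)%:A - chebS (k - 1) z *: g^-1.
Proof.
move=> gU trg.
have gE : g = z%:A - g^-1 by rewrite -trg addrK.
have gVgV : g^-1 * g^-1 = z *: g^-1 - 1.
  by rewrite -mulr_algl -trg mulrDl mulrV // addrC addKr.
elim/int_ind: k => [|k IHk|k IHk].
- by rewrite expr0z /= scale0r subr0 scale1r.
- rewrite -addn1 PoszD exprzDr // expr1z IHk addrK (chebS_rec (k%:Z + 1)).
  rewrite (_ : k%:Z + 1 - 2 = k%:Z - 1) ?addrK; last by ring.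
  rewrite mulrBl -!scalerAl mul1r mulVr // {1}gE scalerBr scalerA.
  by rewrite [z * _]mulrC scalerBl addrAC.
- rewrite -addn1 PoszD opprD exprzDr // exprN1 IHk (chebS_rec (- k%:Z)).
  rewrite (_ : - k%:Z - 1 - 1 = - k%:Z - 2); last by ring.
  rewrite mulrBl -!scalerAl mul1r gVgV scalerBr scalerA !scalerBl.
  by rewrite [z * _]mulrC opprB addrC addrA subrK.
Qed.

(** * Polynomials in two variables are determined by their values *)

Lemma poly_zero_inj (R : idomainType) (f : nat -> R) (p : {poly R}) :
  injective f -> (forall i, p.[f i] = 0) -> p = 0.
Proof.
move=> f_inj pf0; apply/eqP; apply: contraT => p0.
have /(_ (map f (iota 0 (size p)))) := max_poly_roots p0.
rewrite size_map size_iota ltnn map_inj_uniq // iota_uniq => -> //.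
by apply/allP=> _ /mapP[i _ ->]; apply/rootP.
Qed.

(** In characteristic zero the naturals are infinitely many points, so the root bound applies to the
    outer variable at constant polynomials, then to the inner one. *)
Lemma bipoly_zero (F : numFieldType) (P : {poly {poly F}}) :
  (forall x y, P.[x, y] = 0) -> P = 0.
Proof.
have natr_inj : injective (fun i : nat => i%:R : F).
  by move=> i j /eqP; rewrite eqr_nat => /eqP.
move=> P0; apply: (poly_zero_inj _ (fun i => (i%:R)%:P)) => [i j /polyC_inj|i].
  exact: natr_inj.
by apply: (poly_zero_inj _ _ _ natr_inj) => j; apply: P0.
Qed.

Section SL2.
Variable C : numClosedFieldType.
Implicit Types (t u : C) (k n m : int).

Lemma xy_poly_unique (f : C -> C -> C) P : xy_poly f P -> unique (xy_poly f) P.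
Proof.
move=> Pf; split=> // Q Qf; apply/eqP; rewrite -subr_eq0; apply/eqP.
apply: bipoly_zero => x y.
(* The roots [(x + s) / 2] and [(x - s) / 2] of T^2 - x T + 1 have product 1 and sum [x], so they
   are [t] and [t^-1]. *)
pose s := sqrtC (x ^+ 2 - 4); pose t := (x + s) / 2.
have tt' : t * ((x - s) / 2) = 1.
  have ss : s ^+ 2 = x ^+ 2 - 4 by rewrite sqrtCK.
  by rewrite /t; field: ss.
have t0 : t != 0.
  by apply: contra_eq_neq tt' => ->; rewrite mul0r eq_sym oner_eq0.
have := Pf t (y - 2) t0; rewrite -(Qf _ _ t0) trabE // subrK traE.
have -> : t^-1 = (x - s) / 2 by apply: (mulfI t0); rewrite tt' mulfV.
have -> : t + (x - s) / 2 = x by rewrite /t; field.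
by move=> PQ; rewrite !hornerE PQ subrr.
Qed.

(** * Explicit 2 x 2 matrices and powers in SL_2 *)

Lemma mulmx2 (p q r s p' q' r' s' : C) :
  mx2 p q r s * mx2 p' q' r' s' =
  mx2 (p * p' + q * r') (p * q' + q * s') (r * p' + s * r') (r * q' + s * s').
Proof.
apply/matrixP=> i j; rewrite !mxE !big_ord_recl big_ord0 !mxE /= addr0.
by case: i => [[|[|]]] //= ?; case: j => [[|[|]]].
Qed.

Lemma mx2_1 : 1 = mx2 1 0 0 1 :> 'M[C]_2.
Proof.
apply/matrixP=> i j; rewrite !mxE.
by case: i => [[|[|]]] //= ?; case: j => [[|[|]]].
Qed.

Lemma mx2_eta (g : 'M[C]_2) : g = mx2 (g 0 0) (g 0 1) (g 1 0) (g 1 1).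
Proof.
apply/matrixP=> i j; rewrite !mxE.
case: i => [[|[|]]] //= ?; case: j => [[|[|]]] //= ?; congr (g _ _);
  exact: val_inj.
Qed.

Lemma trmx2 (p q r s : C) : \tr (mx2 p q r s) = p + s.
Proof. by rewrite /mxtrace !big_ord_recl big_ord0 !mxE /= addr0. Qed.

Lemma invmx2 (p q r s : C) : p * s - q * r = 1 ->
  (mx2 p q r s)^-1 = mx2 s (- q) (- r) p.
Proof.
move=> det1.
have gU : mx2 p q r s \is a GRing.unit by rewrite unitmxE det_mx2 det1 unitr1.
apply: (mulrI gU); rewrite divrr // mulmx2 mx2_1.
by congr mx2; rewrite -?det1; ring.
Qed.

Lemma SL2_unit (g : 'M[C]_2) : \det g = 1 -> g \is a GRing.unit.
Proof. by rewrite unitmxE => ->; rewrite unitr1. Qed.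

Lemma SL2_addV (g : 'M[C]_2) : \det g = 1 -> g + g^-1 = (\tr g)%:A.
Proof.
rewrite [g]mx2_eta det_mx2 => /invmx2->; rewrite trmx2 mx2_1.
apply/matrixP=> i j; rewrite !mxE.
by case: i => [[|[|]]] //= ?; case: j => [[|[|]]] //= ?; ring.
Qed.

Lemma SL2_exprz (g : 'M[C]_2) k : \det g = 1 ->
  g ^ k = (chebS k (\tr g))%:A - chebS (k - 1) (\tr g) *: g^-1.
Proof. by move=> g1; apply: exprz_chebS (SL2_unit _ g1) (SL2_addV _ g1). Qed.

(** * Traces and the Riley form at a fixed pair [t], [u] *)

Section RileyValue.
Variables (t u : C).
Hypothesis t0 : t != 0.
Local Notation a := (rho_a t).
Local Notation b := (rho_b t u).
Local Notation c := (word_c a b).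
Local Notation x := (t + t^-1).
Local Notation y := (u + 2).
Local Notation alpha := (tralpha t u).
Local Notation beta m := (trbeta m t u).

(** Linearity of this form allows the expansion of each matrix power to be evaluated term by
    term. *)
Definition riley_form (M : 'M[C]_2) : C := M 0 0 + (t^-1 - t) * M 0 1.

Lemma riley_form_mx2 p q r s : riley_form (mx2 p q r s) = p + (t^-1 - t) * q.
Proof. by rewrite /riley_form !mxE. Qed.

Lemma riley_formB M N : riley_form (M - N) = riley_form M - riley_form N.
Proof. by rewrite /riley_form !mxE; ring. Qed.

Lemma riley_formZ (k : C) (M : 'M[C]_2) : riley_form (k *: M) = k * riley_form M.
Proof. by rewrite /riley_form !mxE; ring. Qed.

Lemma invr_rho_a : a^-1 = mx2 t^-1 (- 1) 0 t.
Proof. by rewrite invmx2 ?oppr0 // mulr0 subr0 mulfV. Qed.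

Lemma invr_rho_b : b^-1 = mx2 t^-1 0 u t.
Proof. by rewrite invmx2 ?oppr0 ?opprK // mul0r subr0 mulfV. Qed.

Let aU : a \is a GRing.unit := rho_a_unit t0.
Let bU : b \is a GRing.unit := rho_b_unit u t0.

Lemma det_word_c : \det c = 1.
Proof.
rewrite /word_c !det_mulmx !det_inv mulrAC mulfK; last first.
  by rewrite -unitfE -unitmxE.
by rewrite mulfV // -unitfE -unitmxE.
Qed.

Lemma word_cV : c^-1 = b * a * b^-1 * a^-1.
Proof.
have cU := SL2_unit _ det_word_c.
apply: (mulrI cU); rewrite mulrV // /word_c !mulrA.
by rewrite mulrVK // mulrVK // mulrK // mulrV.
Qed.

Lemma tralphaE : alpha = y ^+ 2 - x ^+ 2 * y + 2 * x ^+ 2 - 2.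
Proof.
rewrite /tralpha /word_c invr_rho_a invr_rho_b !mulmx2 trmx2.
by field.
Qed.

(* Unlike the closed form of the paper, this keeps S_k at negative indices: it
   comes directly from expanding both c^m and c^-m in tr(c^m a c^-m b). *)
Lemma trbetaE m : beta m =
    (x ^+ 2 - y) * (chebS m alpha * chebS (- m) alpha
      - (alpha - 1) * (chebS m alpha * chebS (- m - 1) alpha)
      - chebS (m - 1) alpha * chebS (- m) alpha)
    + (x ^+ 2 * (alpha - 1) - y)
      * (chebS (m - 1) alpha * chebS (- m - 1) alpha).
Proof.
rewrite /trbeta /word_v !SL2_exprz ?det_word_c // -/alpha.
rewrite !(mulrBl, mulrBr) -!(scalerAl, scalerAr) !mul1r !mulr1.
rewrite !linearB /= !linearZ /=.
rewrite word_cV !tralphaE invr_rho_a invr_rho_b !mulmx2 !trmx2.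
set s1 := chebS m _; set s2 := chebS (- m) _; set s3 := chebS (m - 1) _.
set s4 := chebS (- m - 1) _.
by field.
Qed.

Lemma det_word_v m : \det (word_v a b m) = 1.
Proof.
have cU := SL2_unit _ det_word_c.
have a1 : \det a = 1 by rewrite det_mx2 mulfV // mulr0 subr0.
have b1 : \det b = 1 by rewrite det_mx2 mulfV // mul0r subr0.
(* The factors c^m and c^(-m) of v contribute cancelling determinants. *)
rewrite /word_v !det_mulmx a1 b1 !mulr1 -det_mulmx.
by rewrite [_ *m _](_ : _ = 1) ?det1 // -[LHS]exprzDr // subrr expr0z.
Qed.

Lemma riley_form_cab m : riley_form (c ^ m * a * b) =
  (x ^+ 2 - y - 1) * chebS m alpha - chebS (m - 1) alpha.
Proof.
rewrite SL2_exprz ?det_word_c // -/alpha.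
(* Since c^-1 = b a b^-1 a^-1, the product c^-1 a b collapses to b a. *)
have -> (k l : C) : ((k *: 1 : 'M[C]_2) - l *: c^-1) * a * b =
    k *: (a * b) - l *: (b * a).
  by rewrite !mulrBl -!scalerAl mul1r word_cV mulrVK // mulrVK.
rewrite riley_formB !riley_formZ !mulmx2 !riley_form_mx2.
by field.
Qed.

Lemma riley_form_bcb m : riley_form (b^-1 * c ^ m * b) =
  (x ^+ 2 - y - 1) * chebS (m - 1) alpha - chebS (m - 2) alpha.
Proof.
(* The expansion of c^m involves only the indices [m] and [m - 1], so [m - 2] is eliminated
   first. *)
have -> : chebS (m - 2) alpha = alpha * chebS (m - 1) alpha - chebS m alpha.
  by rewrite (chebS_rec m) subKr.
rewrite SL2_exprz ?det_word_c // -/alpha.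
rewrite mulrBr mulrBl -!scalerAr -!scalerAl mulr1 mulVr //.
rewrite riley_formB !riley_formZ mx2_1 word_cV tralphaE.
rewrite invr_rho_a invr_rho_b !mulmx2 !riley_form_mx2.
by field.
Qed.

Lemma rileyE n m : riley n m t u =
  ((x ^+ 2 - y - 1) * chebS m alpha - chebS (m - 1) alpha) * chebS n (beta m)
  - ((x ^+ 2 - y - 1) * chebS (m - 1) alpha - chebS (m - 2) alpha)
    * chebS (n - 1) (beta m).
Proof.
rewrite -riley_form_cab -riley_form_bcb -[LHS]/(riley_form _) /word_w.
rewrite SL2_exprz ?det_word_v // -/(beta m).
have cU : c \is a GRing.unit := SL2_unit _ det_word_c.
have -> : b^-1 * c ^ m * b = (word_v a b m)^-1 * c ^ m * a * b.
  (* After multiplication by v, use v b^-1 = c^m a c^(-m). *)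
  apply: (mulrI (SL2_unit _ (det_word_v m))).
  rewrite !mulrA mulrV ?SL2_unit ?det_word_v // mul1r /word_v.
  by rewrite mulrK // -(mulrA _ (c ^ (- m))) -exprzDr // addNr expr0z mulr1.
rewrite !mulrBl -!scalerAl mul1r riley_formB !riley_formZ.
by rewrite mulrC [X in _ - X]mulrC.
Qed.

End RileyValue.
End SL2.

Theorem proposition2p5 (C : numClosedFieldType) (n m : int)
    (hn : n != 0) (hm : m != 0) :
  exists alpha beta : {poly {poly C}},
    [/\ unique (xy_poly (@tralpha C)) alpha,
        unique (xy_poly (@trbeta C m)) beta
      & unique (xy_poly (@riley C n m))
          ((('X ^+ 2 - 'Y - 1) * chebS m alpha - chebS (m - 1) alpha)
             * chebS n beta
           - (('X ^+ 2 - 'Y - 1) * chebS (m - 1) alpha - chebS (m - 2) alpha)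
             * chebS (n - 1) beta)].
Proof.
(* Evaluation at a point is packaged as a ring morphism so that it commutes with [chebS]; the
   identities between values then give the polynomial witnesses. *)
pose ev (x y : C) : {rmorphism {poly {poly C}} -> C} :=
  horner_eval y \o horner_eval x%:P.
have evE x y P : P.[x, y] = ev x y P by [].
have evX x y : ev x y 'X = x by rewrite -evE !hornerE.
have evY x y : ev x y 'Y = y by rewrite -evE !hornerE.
pose alpha : {poly {poly C}} := 'Y ^+ 2 - 'X ^+ 2 * 'Y + 2 * 'X ^+ 2 - 2.
pose beta : {poly {poly C}} :=
    ('X ^+ 2 - 'Y) * (chebS m alpha * chebS (- m) alpha
      - (alpha - 1) * (chebS m alpha * chebS (- m - 1) alpha)
      - chebS (m - 1) alpha * chebS (- m) alpha)
    + ('X ^+ 2 * (alpha - 1) - 'Y)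
      * (chebS (m - 1) alpha * chebS (- m - 1) alpha).
pose morphE := (rmorphB, rmorphD, rmorphM, rmorphXn, rmorph1, rmorph_nat,
                rmorph_chebS, evX, evY).
have ev_alpha : xy_poly (@tralpha C) alpha.
  by move=> t u t0; rewrite tralphaE // evE !morphE trabE // traE.
have ev_beta : xy_poly (@trbeta C m) beta.
  move=> t u t0; rewrite trbetaE // -ev_alpha // !evE /beta !morphE.
  by rewrite trabE // traE.
exists alpha, beta; split; apply: xy_poly_unique => // t u t0.
rewrite rileyE // -ev_alpha // -ev_beta // !evE !morphE.
by rewrite trabE // traE.
Qed.
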